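(* Let $\mathbf K=(K,\leq,{}')$ be a finite representable Kleene poset with an odd number of elements. Then ${}'$ has exactly one fixed point $a$, and there exists some subposet $\mathbf A=(A,\leq)$ of $(K,\leq)$ of cardinality less than $|K|/2+1$ containing $a$ such that $\mathbf P_a(\mathbf A)\cong\mathbf K$.
   Context: Let $(A,\leq)$ be a poset. For $B,C\subseteq A$, $B\leq C$ means $x\leq y$ for all $x\in B$, $y\in C$. $L(B)=\{x\in A\mid x\leq B\}$, $U(B)=\{x\in A\mid B\leq x\}$; several arguments denote the union, e.g. $L(b,c)=L(\{b,c\})$, $L(B,c)=L(B\cup\{c\})$; $LU(B)=L(U(B))$. The poset is distributive if $L\big(U(x,y),z\big)=LU\big(L(x,z),L(y,z)\big)$ for all $x,y,z$. An antitone involution is a unary operation ${}'$ with $x\leq y\Rightarrow y'\leq x'$ and $x''=x$. A Kleene poset is a distributive poset with an antitone involution ${}'$ such that $L(x,x')\leq U(y,y')$ for all $x,y$. For a non-empty subset $S\subseteq A$, $P_S(\mathbf A)=\{(x,y)\in A^2\mid L(x,y)\leq S\leq U(x,y)\}$, and $\mathbf P_S(\mathbf A)=\big(P_S(\mathbf A),\sqsubseteq,{}'\big)$, where $(x,y)\sqsubseteq(z,u)$ iff $x\leq z$ and $u\leq y$, and $(x,y)'=(y,x)$. $\mathbf P_a(\mathbf A)$ means $\mathbf P_{\{a\}}(\mathbf A)$ (cones computed in $\mathbf A$). A Kleene poset $\mathbf K$ is representable if there exist a poset $\mathbf A^*$ and a non-empty subset $S$ of $\mathbf A^*$ with $\mathbf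 K\cong\mathbf P_S(\mathbf A^* )$ (isomorphism of posets with unary operation). *)

(* Defs.v *)
From HB Require Import structures.
From mathcomp Require Import all_boot all_order all_algebra.
From mathcomp Require Import boolp classical_sets.

Set Implicit Arguments.
Unset Strict Implicit.
Unset Printing Implicit Defensive.

Import Order.TTheory.
Local Open Scope order_scope.
Local Open Scope classical_set_scope.

(* The cones L(B) and U(B) are [lbound B] and [ubound B]. *)

Definition set_le d (A : porderType d) (B C : set A) : Prop :=
  forall x y, B x -> C y -> x <= y.

Definition distributive_poset d (A : porderType d) : Prop :=
  forall x y z : A,
    lbound (ubound [set x; y] `|` [set z]) =
    lbound (ubound (lbound [set x; z] `|` lbound [set y; z])).

Definition antitone_involution d (A : porderType d) (c : A -> A) : Prop :=
  {homo c : x y /~ x <= y} /\ involutive c.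

Definition kleene_poset d (A : porderType d) (c : A -> A) : Prop :=
  [/\ distributive_poset A, antitone_involution c &
      forall x y : A, set_le (lbound [set x; c x]) (ubound [set y; c y])].

Definition twist_set d (A : porderType d) (S : set A) : set (A * A) :=
  [set p | set_le (lbound [set p.1; p.2]) S /\ set_le S (ubound [set p.1; p.2])].

Definition twist d (A : porderType d) (S : set A) : Type := set_type (twist_set S).

HB.instance Definition _ d (A : porderType d) (S : set A) :=
  Choice.on (@twist d A S).
HB.instance Definition _ d (A : porderType d) (S : set A) :=
  SubType.on (@twist d A S).

Definition twist_le d (A : porderType d) (S : set A) (p q : twist S) : bool :=
  ((val p).1 <= (val q).1) && ((val q).2 <= (val p).2).

Fact twist_le_refl d (A : porderType d) (S : set A) : reflexive (@twist_le d A S).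
Proof. by move=> p; rewrite /twist_le !lexx. Qed.

Fact twist_le_anti d (A : porderType d) (S : set A) :
  antisymmetric (@twist_le d A S).
Proof.
move=> p q /andP[/andP[h1 h2] /andP[h3 h4]]; apply/val_inj.
rewrite (surjective_pairing (val p)) (surjective_pairing (val q)).
by congr pair; apply/le_anti/andP.
Qed.

Fact twist_le_trans d (A : porderType d) (S : set A) :
  transitive (@twist_le d A S).
Proof.
move=> q p r /andP[h1 h2] /andP[h3 h4].
by apply/andP; split; [exact: le_trans h3 | exact: le_trans h2].
Qed.

HB.instance Definition _ d (A : porderType d) (S : set A) :=
  Order.Le_isPOrder.Build d (@twist d A S)
    (@twist_le_refl d A S) (@twist_le_anti d A S) (@twist_le_trans d A S).

Fact twist_swap_subproof d (A : porderType d) (S : set A) (p : twist S) :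
  ((val p).2, (val p).1) \in twist_set S.
Proof.
by have := valP p; rewrite !inE /twist_set /= [[set (val p).2; _]]setUC.
Qed.

Definition twist_swap d (A : porderType d) (S : set A) (p : twist S) : twist S :=
  exist _ ((val p).2, (val p).1) (twist_swap_subproof p).

(* The subset [A] as a poset in its own right: bounds taken in [subposet A]
   range over the elements of [A] only. *)
Definition subposet d (K : finPOrderType d) (A : {set K}) : Type :=
  {x : K | x \in A}.

HB.instance Definition _ d (K : finPOrderType d) (A : {set K}) :=
  SubChoice.on (@subposet d K A).
HB.instance Definition _ d (K : finPOrderType d) (A : {set K}) :=
  [SubChoice_isSubPOrder of (@subposet d K A) by <: with d].

Definition poset_op_iso d1 (A : porderType d1) (f : A -> A)
    d2 (B : porderType d2) (g : B -> B) : Prop :=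
  exists h : A -> B,
    [/\ bijective h, {mono h : x y / x <= y} & {morph h : x / f x >-> g x}].

Definition representable d (K : porderType d) (c : K -> K) : Prop :=
  exists (d' : Order.disp_t) (A : porderType d') (S : set A),
    S !=set0 /\ poset_op_iso c (@twist_swap d' A S).

(* Main.v *)
Require Import Defs.
From mathcomp Require Import all_boot all_order all_algebra.
From mathcomp Require Import boolp classical_sets.
From mathcomp Require Import lra.

(** Write K as P_S(B) with S non-empty.  The pairs fixed by the swap are the
    diagonal ones, and a diagonal pair (x, x) lies in P_S(B) only when S = {x}, because
    x <= S <= x ([twist_diag]).  So the involution has at most one fixed point;
    since an involution of a set of odd cardinality has at least one
    ([odd_involution_fixpoint]), there is exactly one, a, and S is a singleton
    {a0} with a corresponding to (a0, a0).

    For a singleton, (x, a0) belongs to P_{a0}(B) for every x in B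
    ([twist_set_base]), so x |-> (x, a0) embeds B in K as the subposet
    A of the elements with second component a0, and a0 is sent to a.  Since
    P_a depends only on the isomorphism type of the pointed poset
    ([twist_image_iso]), P_a(A) is isomorphic to P_{a0}(B), that is, to K.

    Finally A' consists of the pairs (a0, x), so A and A' have the same
    cardinality and meet in a only, whence 2|A| <= |K| + 1. *)

Set Implicit Arguments.
Unset Strict Implicit.
Unset Printing Implicit Defensive.

Import Order.TTheory GRing.Theory Num.Theory.
Local Open Scope order_scope.

(** The elements moved by f come in pairs {x, f x}; an arbitrary enumeration
    of T singles out one element of each pair, so f exchanges the moved
    elements that precede their image with those that follow it. *)
Lemma odd_involution_fixpoint (T : finType) (f : T -> T) :
  involutive f -> odd #|T| -> exists x, f x = x.
Proof.
move=> fK oddT; have [/existsP[x /eqP fx]|nofix] := boolP [exists x, f x == x].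
  by exists x.
pose low := [set x | enum_rank x < enum_rank (f x)]%N.
have f_low : f @: low = ~: low.
  apply/setP=> x; rewrite (can_imset_pre _ fK) !inE fK.
  rewrite -leqNgt [RHS]leq_eqVlt; case: eqVneq => //= /ord_inj/enum_rank_inj fx.
  by move/existsPn: nofix => /(_ x); rewrite fx eqxx.
have := cardsC low; rewrite -f_low (card_imset _ (inv_inj fK)) => cardT.
by move: oddT; rewrite -cardT oddD addbb.
Qed.

Section Twist.
Context {d : Order.disp_t} {A : porderType d}.
Local Open Scope classical_set_scope.

Lemma twist_setP (S : set A) (x y : A) :
  twist_set S (x, y) <->
  forall s, S s -> (forall z, z <= x -> z <= y -> z <= s) /\
                   (forall z, x <= z -> y <= z -> s <= z).
Proof.
split=> [[/= lS uS] s Ss | H].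
  by split=> z zx zy; [apply: lS | apply: uS] => // t [] ->.
split=> /= s t; first by move=> ls /H[l _]; apply: l; apply: ls; [left | right].
by move=> /H[_ u] us; apply: u; apply: us; [left | right].
Qed.

Lemma twist_diag (S : set A) (x : A) :
  S !=set0 -> twist_set S (x, x) -> S = [set x].
Proof.
move=> [s0 Ss0] /twist_setP H.
have eqx s : S s -> s = x.
  by move=> /H[l u]; apply/le_anti; rewrite l ?u.
by apply/seteqP; split=> [s /eqx //|s ->]; rewrite -(eqx _ Ss0).
Qed.

Lemma twist_set_base (a x : A) : twist_set [set a] (x, a).
Proof. by apply/twist_setP => s ->. Qed.

End Twist.

Section Isomorphisms.

Lemma poset_op_iso_sym d1 (A : porderType d1) f d2 (B : porderType d2) g :
  @poset_op_iso d1 A f d2 B g -> @poset_op_iso d2 B g d1 A f.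
Proof.
case=> h [[k hK kK] hle hf]; exists k; split; first by exists h.
  by move=> x y; rewrite -hle !kK.
by move=> x; apply: (can_inj hK); rewrite hf !kK.
Qed.

Lemma poset_op_iso_trans d1 (A : porderType d1) f d2 (B : porderType d2) g
    d3 (C : porderType d3) k :
  @poset_op_iso d1 A f d2 B g -> @poset_op_iso d2 B g d3 C k ->
  @poset_op_iso d1 A f d3 C k.
Proof.
case=> h [hbij hle hf] [h' [hbij' hle' hf']]; exists (h' \o h); split.
- exact: bij_comp.
- by move=> x y /=; rewrite hle' hle.
- by move=> x /=; rewrite hf hf'.
Qed.

Local Open Scope classical_set_scope.

(** Membership in [twist_set] is expressed by the order alone, so both an order
    isomorphism and its inverse preserve it. *)
Lemma twist_set_image d1 (A : porderType d1) d2 (B : porderType d2)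
    (e : A -> B) (S : set A) (x y : A) :
  bijective e -> {mono e : u v / u <= v} ->
  twist_set (e @` S) (e x, e y) <-> twist_set S (x, y).
Proof.
case=> e' eK e'K ele; split=> /twist_setP H; apply/twist_setP.
  move=> s Ss; have [|l u] := H (e s); first by exists s.
  by split=> z zx zy; rewrite -ele; [apply: l | apply: u]; rewrite ele.
move=> _ [s Ss <-]; have [l u] := H s Ss.
by split=> z; rewrite -[z]e'K !ele; [apply: l | apply: u].
Qed.

Lemma twist_image_iso d1 (A : porderType d1) d2 (B : porderType d2)
    (e : A -> B) (S : set A) :
  bijective e -> {mono e : u v / u <= v} ->
  poset_op_iso (@twist_swap d1 A S) (@twist_swap d2 B (e @` S)).
Proof.
move=> ebij ele; have [e' eK e'K] := ebij.
have fP (p : twist S) : (e (val p).1, e (val p).2) \in twist_set (e @` S).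
  rewrite inE; apply/twist_set_image => //.
  by have := valP p; rewrite inE; case: (val p).
have gP (q : twist (e @` S)) : (e' (val q).1, e' (val q).2) \in twist_set S.
  rewrite inE; apply/(twist_set_image S _ _ ebij ele); rewrite !e'K.
  by have := valP q; rewrite inE; case: (val q).
pose f p : twist (e @` S) := exist _ (e (val p).1, e (val p).2) (fP p).
pose g q : twist S := exist _ (e' (val q).1, e' (val q).2) (gP q).
exists f; split.
- by exists g => p; apply/val_inj;
    rewrite /= ?eK ?e'K; case: (val p).
- by move=> p q; rewrite /Order.le /= /twist_le /= !ele.
- by move=> p; apply/val_inj.
Qed.

End Isomorphisms.

Theorem theorem4p9 (d : Order.disp_t) (K : finPOrderType d) (c : K -> K)
    (kleeneK : kleene_poset c) (reprK : representable c) (oddK : odd #|K|) :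
  exists a : K,
    unique (fun x : K => c x = x) a /\
    exists (A : {set K}) (aA : a \in A),
      (#|A|%:R < #|K|%:R / 2%:R + 1 :> rat)%R /\
      poset_op_iso
        (@twist_swap d (subposet A)
           [set (exist _ a aA : subposet A)]%classic) c.
Proof.
have [_ [_ cK] _] := kleeneK.
have [d' [B [S [S0 [h [[g hK gK] hle hc]]]]]] := reprK.
have [a ca] := odd_involution_fixpoint cK oddK.
have fix_diag x : c x = x -> (val (h x)).1 = (val (h x)).2.
  by move=> cx; rewrite -{2}cx hc.
set a0 := (val (h a)).2.
have ha : val (h a) = (a0, a0).
  by rewrite [LHS]surjective_pairing fix_diag.
have ES : S = [set a0]%classic.
  by apply: twist_diag => //; have := valP (h a); rewrite inE ha.
move: (a0) ha ES => {}a0 ha ES; subst S.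
exists a; split.
  split=> // x cx; apply: (can_inj hK); apply/val_inj; rewrite ha.
  have := valP (h x); rewrite inE [val (h x)]surjective_pairing.
  rewrite (fix_diag x cx).
  by move/(twist_diag S0)/seteqP => [/(_ a0 erefl) <- _].
pose A := [set k : K | (val (h k)).2 == a0].
have aA : a \in A by rewrite inE ha.
exists A, aA; split.
  (* c swaps components, so an element of both A and its image has both
     components equal to a0. *)
  have meet : A :&: (c @: A) \subset [set a].
    apply/fintype.subsetP => k; rewrite (can_imset_pre _ cK) !inE hc /=.
    case/andP => /eqP k2 /eqP k1; apply/eqP/(can_inj hK)/val_inj.
    by rewrite ha [LHS]surjective_pairing k1 k2.
  have cardA : (#|A| + #|A| <= #|K| + 1)%N.
    rewrite -{2}(card_imset A (inv_inj cK)) -cardsUI leq_add ?max_card //.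
    by rewrite -(cards1 a) subset_leq_card.
  have : (#|A|%:R + #|A|%:R <= #|K|%:R + 1 :> rat)%R.
    by rewrite -natrD natr1 ler_nat -addn1.
  by move=> ?; lra.
pose e (k : subposet A) : B := (val (h (val k))).1.
have base_in x : (x, a0) \in twist_set [set a0]%classic.
  by rewrite inE; apply: twist_set_base.
pose base x : twist [set a0]%classic := exist _ (x, a0) (base_in x).
have inA x : g (base x) \in A by rewrite inE gK.
have A2 (k : subposet A) : (val (h (val k))).2 = a0.
  by have := valP k; rewrite inE => /eqP.
have ebij : bijective e.
  pose e' x : subposet A := exist _ (g (base x)) (inA x).
  exists e' => [k|x]; last by rewrite /e /= gK.
  apply/val_inj/(can_inj hK)/val_inj; rewrite /= gK.
  by rewrite [RHS]surjective_pairing A2.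
have ele : {mono e : x y / x <= y}.
  move=> x y; rewrite -[RHS]/(val x <= val y) -hle.
  by rewrite [RHS]/Order.le /= /twist_le !A2 lexx andbT.
apply: poset_op_iso_trans (twist_image_iso _ ebij ele) _.
have -> : (e @` [set (exist _ a aA : subposet A)] = [set a0])%classic.
  by rewrite image_set1 /e /= ha.
apply: poset_op_iso_sym.
by exists h; split=> //; exists g.
Qed.
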